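(* Let $r$ be a nonnegative integer. For every integer $n\geq 0$, we have the polynomial identity in $x$ $$(r+x)^n=\sum_{l=0}^n\sum_{k=0}^l (x)_k\binom{n}{l}T_r(l+r,k+r)\left(\frac{k}{2}\right)^{n-l}.$$
   Context: Falling factorials: $(x)_0=1$ and $(x)_n=x(x-1)\cdots(x-n+1)$ for $n\ge 1$. For a nonnegative integer $r$, the extended $r$-central factorial numbers of the second kind $T_r(n+r,k+r)$ ($n\ge k\ge 0$) are defined by the formal power series identity $$\frac{1}{k!}e^{rt}\left(e^{t/2}-e^{-t/2}\right)^k=\sum_{n=k}^\infty T_r(n+r,k+r)\frac{t^n}{n!},\qquad k\ge 0.$$ Convention: $0^0=1$. *)

(* Defs.v *)
From mathcomp Require Import all_boot all_order all_algebra.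
Set Implicit Arguments.
Unset Strict Implicit.
Unset Printing Implicit Defensive.
Import GRing.Theory.
Local Open Scope ring_scope.

(* A formal power series in t over rat is its coefficient sequence:
   f stands for \sum_n f n * t^n. *)
Definition fps := nat -> rat.

Definition fps_one : fps := fun n => (n == 0%N)%:R.

Definition fps_sub (f g : fps) : fps := fun n => f n - g n.

Definition fps_scale (c : rat) (f : fps) : fps := fun n => c * f n.

Definition fps_mul (f g : fps) : fps :=
  fun n => \sum_(i < n.+1) f i * g (n - i)%N.

Definition fps_exp (f : fps) (k : nat) : fps := iter k (fps_mul f) fps_one.

(* the formal series e^{a t} *)
Definition fps_expt (a : rat) : fps := fun n => a ^+ n / n`!%:R.

(* (1/k!) e^{rt} (e^{t/2} - e^{-t/2})^k *)
Definition central_gf (r k : nat) : fps :=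
  fps_scale (k`!%:R)^-1
    (fps_mul (fps_expt r%:R)
       (fps_exp (fps_sub (fps_expt (1 / 2)) (fps_expt (- (1 / 2)))) k)).

(* T_r(N, K), with the shifted indices N = n + r and K = k + r:
   n! times the coefficient of t^n in the generating function for k.
   Only meaningful for r <= K <= N. *)
Definition rcentral (r N K : nat) : rat :=
  (N - r)%N`!%:R * central_gf r (K - r)%N (N - r)%N.

Definition falling (R : pzRingType) (x : R) (n : nat) : R :=
  \prod_(i < n) (x - i%:R).

Lemma fps_mul_low (f g : fps) (a b : nat) :
  (forall n, (n < a)%N -> f n = 0) -> (forall n, (n < b)%N -> g n = 0) ->
  forall n, (n < a + b)%N -> fps_mul f g n = 0.
Proof.
move=> f0 g0 n ltn; apply: big1 => i _.
have [lt_ia|le_ai] := ltnP i a; first by rewrite f0 ?mul0r.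
rewrite g0 ?mulr0 //.
have le_in : (i <= n)%N by rewrite -ltnS.
by rewrite ltn_subLR // (leq_trans ltn) // leq_add2r.
Qed.

Lemma central_gf_low (r k n : nat) : (n < k)%N -> central_gf r k n = 0.
Proof.
move=> lt_nk; rewrite /central_gf /fps_scale.
rewrite (@fps_mul_low _ _ 0 k) ?mulr0 // => {lt_nk}{}n.
elim: k n => [//|k IHk] n lt_nk.
rewrite /fps_exp iterS; apply: (@fps_mul_low _ _ 1 k) => // -[|//] _.
by rewrite /fps_sub /fps_expt !expr0 subrr.
Qed.

(* The generating function identity defining T_r, coefficientwise: the series
   on the right-hand side starts at n = k. *)
Lemma central_gfE (r k n : nat) :
  central_gf r k n =
  if (k <= n)%N then rcentral r (n + r) (k + r) / n`!%:R else 0.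
Proof.
case: leqP => [_|]; last exact: central_gf_low.
rewrite /rcentral !addnK mulrAC divff ?mul1r //.
by rewrite Num.Theory.pnatr_eq0 -lt0n fact_gt0.
Qed.

(* Main.v *)
(** Let [D] be the central difference operator [g |-> g(s + 1/2) - g(s - 1/2)]
    and [p_n(s) = s^n / n!].  Multiplying the series [\sum_n (D^k p_n)(s) t^n] by
    [e^{at}] shifts [s] by [a], so [(e^{t/2} - e^{-t/2})^k] has coefficients
    [(D^k p_n)(0)].  The sum over [l] in the identity is a coefficient of
    [e^{kt/2}] times the generating function, hence equals
    [n!/k! (D^k p_n)(r + k/2)], which is [1/k!] times the [k]-th forward
    difference of [s^n] at [r].  The identity at [x = m] is then Newton's forward
    difference formula, and two polynomials agreeing at all naturals are equal. *)
Require Import Defs.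
From mathcomp Require Import all_boot all_order all_algebra.
From mathcomp Require Import ring.
Import GRing.Theory.
Set Implicit Arguments.
Unset Strict Implicit.
Local Open Scope ring_scope.

(** The difference vanishes at the first [size (p - q)] naturals, which are distinct in [R]: too
    many roots for a nonzero polynomial of that size. *)
Lemma poly_eq_natr (R : numDomainType) (p q : {poly R}) :
  (forall m : nat, p.[m%:R] = q.[m%:R]) -> p = q.
Proof.
move=> epq; apply/eqP; rewrite -subr_eq0; apply/eqP.
apply: (@roots_geq_poly_eq0 _ _ [seq m%:R | m <- iota 0 (size (p - q))]).
- by apply/allP => _ /mapP[m _ ->]; rewrite /root hornerD hornerN epq subrr.
- rewrite map_inj_uniq ?iota_uniq // => i j /eqP.
  by rewrite Num.Theory.eqr_nat => /eqP.
- by rewrite size_map size_iota.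
Qed.

Lemma falling_natr (R : pzRingType) (m k : nat) :
  falling (m%:R : R) k = (m ^_ k)%:R.
Proof.
rewrite /falling; elim: k => [|k IHk]; first by rewrite big_ord0.
rewrite big_ord_recr IHk /= ffactnSr natrM.
have [le_km|lt_mk] := leqP k m; first by rewrite natrB.
by rewrite ffact_small // !mul0r.
Qed.

Lemma horner_falling (R : comNzRingType) (k : nat) (x : R) :
  (falling ('X : {poly R}) k).[x] = falling x k.
Proof.
rewrite /falling horner_prod; apply: eq_bigr => i _.
by rewrite hornerD hornerN hornerX -polyC_natr hornerC.
Qed.

Definition fdiff (R : pzRingType) (g : R -> R) : R -> R :=
  fun s => g (s + 1) - g s.
Arguments fdiff {R} g s.

(** Induction on [m] with [s] free: one step moves the base point to [s + 1], where each difference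
    is the one at [s] plus the next difference at [s]; this is Pascal's rule. Terms beyond [m] have
    zero binomials, so any [N >= m] may end the sum. *)
Lemma newton_forward (R : pzRingType) (g : R -> R) (s : R) (m N : nat) :
  (m <= N)%N ->
  g (s + m%:R) = \sum_(k < N.+1) iter k fdiff g s *+ 'C(m, k).
Proof.
elim: m N s => [|m IHm] N s.
  by move=> _; rewrite big_ord_recl big1 => [|i _]; rewrite /= ?addr0.
case: N => [//|N]; rewrite ltnS => le_mN.
rewrite big_ord_recl bin0 /=.
under eq_bigr => i _ do rewrite /bump /= binS mulrnDr.
rewrite big_split /= addrA.
(* The first halves of Pascal's rule join the leading term in a sum one index longer, whose last
   binomial ['C(m, N.+1)] is zero. *)
have -> : iter 0 fdiff g s *+ 1 +
    \sum_(i < N.+1) iter i.+1 fdiff g s *+ 'C(m, i.+1) =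
    \sum_(i < N.+2) iter i fdiff g s *+ 'C(m, i).
  by rewrite [RHS]big_ord_recl bin0.
rewrite big_ord_recr /= bin_small // mulr0n addr0 -big_split /=.
rewrite -natr1 [m%:R + 1]addrC addrA (IHm N) //.
by apply: eq_bigr => i _; rewrite -mulrnDl /fdiff subrKC.
Qed.

Definition cdiff (g : rat -> rat) : rat -> rat :=
  fun s => g (s + 1 / 2) - g (s - 1 / 2).

(** A central difference at [s + 1/2] is a forward difference at [s]; each of the [k] iterations
    contributes one half step. *)
Lemma iter_cdiff (g : rat -> rat) (k : nat) (s : rat) :
  iter k cdiff g (s + k%:R / 2) = iter k fdiff g s.
Proof.
elim: k s => [|k IHk] s /=; first by rewrite mul0r addr0.
rewrite /cdiff /fdiff -!IHk -natr1.
by congr (iter k cdiff g _ - iter k cdiff g _); field.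
Qed.

Lemma fdiff_scale (c : rat) (g h : rat -> rat) (k : nat) :
  (forall s, g s = c * h s) ->
  forall s, iter k fdiff g s = c * iter k fdiff h s.
Proof.
by move=> gE; elim: k => //= k IHk s; rewrite /fdiff !IHk mulrBr.
Qed.

Lemma eq_fps_mul (f f' g g' : fps) :
  f =1 f' -> g =1 g' -> fps_mul f g =1 fps_mul f' g'.
Proof. by move=> ef eg n; apply: eq_bigr => i _; rewrite ef eg. Qed.

Lemma fps_mulC (f g : fps) : fps_mul f g =1 fps_mul g f.
Proof.
move=> n; rewrite /fps_mul (reindex_inj rev_ord_inj) /=.
by apply: eq_bigr => i _; rewrite subSS subKn ?leq_ord // mulrC.
Qed.

Lemma fps_mulBl (f g h : fps) :
  fps_mul (fps_sub f g) h =1 fps_sub (fps_mul f h) (fps_mul g h).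
Proof.
by move=> n; rewrite /fps_sub -sumrB; apply: eq_bigr => i _; rewrite mulrBl.
Qed.

Lemma fps_mulBr (f g h : fps) :
  fps_mul h (fps_sub f g) =1 fps_sub (fps_mul h f) (fps_mul h g).
Proof.
by move=> n; rewrite /fps_sub -sumrB; apply: eq_bigr => i _; rewrite mulrBr.
Qed.

Lemma fps_mulZr (c : rat) (f g : fps) :
  fps_mul f (fps_scale c g) =1 fps_scale c (fps_mul f g).
Proof.
by move=> n; rewrite /fps_scale mulr_sumr; apply: eq_bigr => i _; rewrite mulrCA.
Qed.

Lemma fact_neq0 (n : nat) : n`!%:R != 0 :> rat.
Proof. by rewrite Num.Theory.pnatr_eq0 -lt0n fact_gt0. Qed.

Lemma bin_natr (n i : nat) : (i <= n)%N ->
  'C(n, i)%:R = n`!%:R / (i`!%:R * (n - i)`!%:R) :> rat.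
Proof.
by move=> le_in; rewrite -(bin_fact le_in) -natrM natrM mulfK // natrM
  mulf_neq0 ?fact_neq0.
Qed.

Lemma fps_exptD (a b : rat) :
  fps_mul (fps_expt a) (fps_expt b) =1 fps_expt (b + a).
Proof.
move=> n; rewrite /fps_mul /fps_expt addrC exprDn mulr_suml.
rewrite (reindex_inj rev_ord_inj) /=; apply: eq_bigr => i _.
rewrite subSS subKn ?leq_ord // -[_ *+ 'C(n, i)]mulr_natr bin_natr ?leq_ord //.
by field; rewrite !fact_neq0.
Qed.

(** This is the series $e^{st}(e^{t/2}-e^{-t/2})^k$, with each factor realized as a central
    difference in [s]. *)
Definition cdiff_fps (k : nat) (s : rat) : fps :=
  fun n => iter k cdiff (fps_expt^~ n) s.

(** Multiplication by a fixed series is additive, hence commutes with differences in [s]; this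
    reduces the claim to the exponential law at [k = 0]. *)
Lemma fps_expt_cdiff (a s : rat) (k : nat) :
  fps_mul (fps_expt a) (cdiff_fps k s) =1 cdiff_fps k (s + a).
Proof.
elim: k s => [|k IHk] s n; first exact: fps_exptD.
rewrite [LHS](fps_mulBr (cdiff_fps k _) (cdiff_fps k _)) /fps_sub !IHk.
by rewrite /cdiff_fps /= {3}/cdiff ![s + _ + a]addrAC.
Qed.

Lemma fps_exp_cdiff (k : nat) :
  fps_exp (fps_sub (fps_expt (1 / 2)) (fps_expt (- (1 / 2)))) k
    =1 cdiff_fps k 0.
Proof.
elim: k => [|k IHk] n.
  rewrite /fps_exp /cdiff_fps /= /fps_one /fps_expt expr0n.
  by case: n => [|n] //=; rewrite mul0r.
(* The two exponentials shift the point 0 to 1/2 and -1/2, so their difference is one more [cdiff]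
   at 0. *)
rewrite /fps_exp iterS (eq_fps_mul (frefl _) IHk) fps_mulBl /fps_sub.
by rewrite !fps_expt_cdiff.
Qed.

Lemma central_gf_cdiff (r k : nat) :
  central_gf r k =1 fps_scale (k`!%:R)^-1 (cdiff_fps k r%:R).
Proof.
move=> n; rewrite /central_gf /fps_scale.
by rewrite (eq_fps_mul (frefl _) (fps_exp_cdiff k)) fps_expt_cdiff add0r.
Qed.

(** Letting [l] run over all of [0..n], with zero terms for [l < k], makes the sum a full Cauchy
    product. The factor $e^{kt/2}$ supplies exactly the shift that [iter_cdiff] needs. *)
Lemma sum_rcentral (r n k : nat) :
  \sum_(l < n.+1)
     'C(n, l)%:R * rcentral r (l + r) (k + r) * (k%:R / 2) ^+ (n - l) =
  (k`!%:R)^-1 * iter k fdiff (fun s => s ^+ n) r%:R.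
Proof.
transitivity (n`!%:R * fps_mul (central_gf r k) (fps_expt (k%:R / 2)) n).
  rewrite mulr_sumr; apply: eq_bigr => l _.
  rewrite /rcentral !addnK /fps_expt bin_natr ?leq_ord //.
  by field; rewrite !fact_neq0.
rewrite fps_mulC (eq_fps_mul (frefl _) (central_gf_cdiff r k)) fps_mulZr.
rewrite /fps_scale fps_expt_cdiff /cdiff_fps iter_cdiff mulrCA; congr (_ * _).
rewrite (@fdiff_scale n`!%:R (fun s => s ^+ n) (fps_expt^~ n)) // => s.
by rewrite /fps_expt mulrC divfK ?fact_neq0.
Qed.

Lemma rcentral_low (r l k : nat) : (l < k)%N -> rcentral r (l + r) (k + r) = 0.
Proof. by move=> lt_lk; rewrite /rcentral !addnK central_gf_low ?mulr0. Qed.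

(** [sum_rcentral] read from right to left: every [l <= n] is below [k], where the generating
    function has no terms. *)
Lemma iter_fdiff_exp_low (r n k : nat) : (n < k)%N ->
  iter k fdiff (fun s : rat => s ^+ n) r%:R = 0.
Proof.
move=> lt_nk; apply: (mulfI (invr_neq0 (fact_neq0 k))).
rewrite mulr0 -sum_rcentral big1 // => l _.
by rewrite rcentral_low ?mulr0 ?mul0r // (leq_trans (ltn_ord l)).
Qed.

Theorem theorem2p3 (r n : nat) :
  (r%:R + 'X) ^+ n =
  \sum_(0 <= l < n.+1) \sum_(0 <= k < l.+1)
    ('C(n, l)%:R * rcentral r (l + r) (k + r) * (k%:R / 2) ^+ (n - l))
      *: falling ('X : {poly rat}) k.
Proof.
apply: poly_eq_natr => m.
rewrite horner_exp hornerD hornerX -polyC_natr hornerC.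
(* The bound [n + m] is at least [m], as Newton's formula requires, and at least [n], so that the
   sum can be cut after [k = n]. *)
rewrite (@newton_forward rat (fun s => s ^+ n) _ m (n + m)) ?leq_addl //.
rewrite -addSn big_split_ord /= [X in _ + X]big1 ?addr0; last first.
  by move=> i _; rewrite -iterS iter_fdiff_exp_low ?mul0rn // ltnS leq_addr.
rewrite big_mkord horner_sum.
(* Extending the inner range from [k <= l] to [k <= n] adds only zero terms and lets the two sums be
   exchanged. *)
transitivity (\sum_(l < n.+1) \sum_(k < n.+1)
  'C(n, l)%:R * rcentral r (l + r) (k + r) * (k%:R / 2) ^+ (n - l)
    * (m ^_ k)%:R); last first.
  apply: eq_bigr => l _; rewrite big_mkord horner_sum.
  under [RHS]eq_bigr => k _ do rewrite hornerZ horner_falling falling_natr.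
  rewrite [RHS](big_ord_widen n.+1 (fun k => 'C(n, l)%:R *
    rcentral r (l + r) (k + r) * (k%:R / 2) ^+ (n - l) * (m ^_ k)%:R)) //.
  rewrite [RHS]big_mkcond; apply: eq_bigr => k _.
  by case: ltnP => // lt_lk; rewrite rcentral_low // mulr0 !mul0r.
rewrite exchange_big; apply: eq_bigr => k _.
(* The falling factorial is the binomial times [k!], which cancels the [1/k!] of [sum_rcentral]. *)
rewrite -mulr_suml sum_rcentral -bin_ffact natrM -mulr_natr.
by field; rewrite fact_neq0.
Qed.
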